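(* For integers $s\geq 1$ and $m_1,\ldots,m_s\geq 1$, define $$\zeta^{\mathcal{C}}_{m_1,m_2,\ldots,m_s}(\underbrace{1,\ldots,1,2}_{s})=\int_{m_1}^{+\infty}\cdots\int_{m_s}^{+\infty}\frac{dx_1\cdots dx_{s-1}\,dx_s}{x_1(x_1+x_2)\cdots(x_1+\cdots+x_{s-1})\,(x_1+\cdots+x_s)^2},$$ where $x_i$ ranges over $[m_i,+\infty)$. For $r\geq 1$ let $\mathfrak{D}_r\mathcal{Z}^{\mathcal{C}}$ be the $\mathbb{Q}$-linear space generated by the continuous multiple zeta values of depth $r$. Then: (i) $\mathfrak{D}_1\mathcal{Z}^{\mathcal{C}}\subseteq\mathfrak{D}_2\mathcal{Z}^{\mathcal{C}}\subseteq\cdots\subseteq\mathfrak{D}_r\mathcal{Z}^{\mathcal{C}}\subseteq\cdots$; (ii) for every $r\geq 1$, $$\mathfrak{D}_r\mathcal{Z}^{\mathcal{C}}\subseteq\big\langle \zeta^{\mathcal{C}}_{m_1,\ldots,m_s}(\underbrace{1,\ldots,1,2}_{s})\,\big|\, s\geq 1,\ m_1+\cdots+m_s=r,\ m_1,\ldots,m_s\geq 1\big\rangle_{\mathbb{Q}},$$ where the right side denotes the $\mathbb{Q}$-linear space generated by the listed elements; (iii) as a result, $\dim_{\mathbb{Q}}\mathfrak{D}_r\mathcal{Z}^{\mathcal{C}}\leq 2^{r-1}$ for all $r\geq 1$.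
   Context: For $r\geq 1$ and integers $k_1,\ldots,k_{r-1}\geq 1$, $k_r\geq 2$, the continuous multiple zeta value of depth $r$ is the (convergent) real number $$\zeta^{\mathcal{C}}(k_1,\ldots,k_r)=\int\cdots\int_{[1,+\infty)^r}\frac{dx_1\cdots dx_r}{x_1^{k_1}(x_1+x_2)^{k_2}\cdots(x_1+\cdots+x_r)^{k_r}}.$$ All $\mathbb{Q}$-linear spaces are subspaces of $\mathbb{R}$. For $s=1$ the defining integral of $\zeta^{\mathcal{C}}_{m_1}(2)$ is $\int_{m_1}^{+\infty}dx_1/x_1^2$. *)

(* Defs.v *)
From HB Require Import structures.
From mathcomp Require Import all_boot all_order all_algebra.
From mathcomp Require Import all_classical all_reals all_analysis.

Set Implicit Arguments.
Unset Strict Implicit.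
Unset Printing Implicit Defensive.

Import Order.TTheory GRing.Theory Num.Theory.
Import numFieldNormedType.Exports.

Local Open Scope classical_set_scope.
Local Open Scope ring_scope.

Section multiple_integrals.
Variable R : realType.
Local Notation RR := (measurableTypeR R).
Local Notation mu := (@lebesgue_measure R).

Definition tuple_snoc n (p : n.-tuple RR * RR) : n.+1.-tuple RR :=
  [tuple of rcons p.1 p.2].

Lemma measurable_tuple_snoc n :
  measurable_fun [set: n.-tuple RR * RR] (@tuple_snoc n).
Proof.
apply/measurable_fun_tnthP => i.
have [ilt|ige] := ltnP i n.
  rewrite (_ : _ \o _ = (fun t : n.-tuple RR => tnth t (Ordinal ilt)) \o fst).
    exact: measurableT_comp (measurable_tnth _) measurable_fst.
  by apply/funext => p /=; rewrite !(tnth_nth 0)/= nth_rcons size_tuple ilt.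
rewrite (_ : _ \o _ = snd) //.
apply/funext => p /=; rewrite (tnth_nth 0)/= nth_rcons size_tuple ltnNge ige /=.
by rewrite eqn_leq ige -ltnS ltn_ord.
Qed.

Section product_snoc.
Variables (n : nat) (m : {measure set (n.-tuple RR) -> \bar R}).

Definition product_snoc : set (n.+1.-tuple RR) -> \bar R :=
  pushforward (m \x mu)%E (@tuple_snoc n).

Let mf := @measurable_tuple_snoc n.

Let product_snoc0 : product_snoc set0 = 0%E.
Proof. exact: measure0. Qed.

Let product_snoc_ge0 A : (0 <= product_snoc A)%E.
Proof. exact: measure_ge0. Qed.

Let product_snoc_sigma_additive : semi_sigma_additive product_snoc.
Proof. exact: measure_semi_sigma_additive. Qed.

HB.instance Definition _ := isMeasure.Build _ _ _ product_snoc
  product_snoc0 product_snoc_ge0 product_snoc_sigma_additive.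

End product_snoc.

(* n-dimensional Lebesgue measure, as the n-fold product of the measure on R *)
Fixpoint lebesgue_tuple n : {measure set (n.-tuple RR) -> \bar R} :=
  match n return {measure set (n.-tuple RR) -> \bar R} with
  | 0 => dirac [tuple]
  | n'.+1 => product_snoc (lebesgue_tuple n')
  end.

(* \int_{m_1}^{+oo} ... \int_{m_s}^{+oo} f(x_1, ..., x_s), where x_i ranges
   over [m_i, +oo[ and x_1 is the outermost variable. *)
Fixpoint iterated_integral (m : seq nat) (f : seq R -> \bar R) : \bar R :=
  if m is a :: m' then
    (\int[mu]_(x in `[a%:R, +oo[) iterated_integral m' (fun s => f (x :: s)))%E
  else f [::].

End multiple_integrals.

Section continuous_zeta.
Variable R : realType.

(* 1 / (x_1 ^ k_1 * (x_1 + x_2) ^ k_2 * ... * (x_1 + ... + x_r) ^ k_r);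
   the sequences k and x are indexed from 0. *)
Definition czeta_integrand (k : seq nat) (x : seq R) : R :=
  (\prod_(i < size k) (\sum_(j < i.+1) x`_j) ^+ nth 0%N k i)^-1.

Definition admissible (k : seq nat) : bool :=
  all (leq 1) k && (2 <= last 0 k)%N.

(* The integrands are nonnegative and the integrals are finite for the indices
   considered, so that [fine] is only the conversion from \bar R to R. *)
Definition czeta r (k : r.-tuple nat) : R :=
  fine (\int[lebesgue_tuple R r]_(x in [set x | forall i, (1 <= tnth x i)%R])
          (czeta_integrand k x)%:E)%E.

(* The exponents are (1, ..., 1, 2), of the same length as m. *)
Definition czeta12 (m : seq nat) : R :=
  fine (iterated_integral m (fun x : seq R =>
          (czeta_integrand (rcons (nseq (size m).-1 1%N) 2%N) x)%:E)).

End continuous_zeta.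

Section rational_spaces.
Variable R : realType.

Definition Qspan (G : set R) : set R :=
  [set x | exists n (a : 'I_n -> rat) (g : 'I_n -> R),
     (forall i, G (g i)) /\ x = \sum_(i < n) ratr (a i) * g i].

Definition Qfree n (b : 'I_n -> R) : Prop :=
  forall a : 'I_n -> rat,
    \sum_(i < n) ratr (a i) * b i = 0 -> forall i, a i = 0.

Definition has_Qdim (V : set R) (n : nat) : Prop :=
  exists2 b : 'I_n -> R, Qfree b & V = Qspan (range b).

Definition DZ (r : nat) : set R :=
  Qspan [set czeta R k | k in [set k : r.-tuple nat | admissible k]].

Definition czeta12_space (r : nat) : set R :=
  Qspan [set czeta12 R m | m in
    [set m : seq nat | [&& (1 <= size m)%N, all (leq 1) m & sumn m == r]]].

End rational_spaces.

Arguments DZ : clear implicits.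
Arguments czeta12_space : clear implicits.

(* Main.v *)
(* In terms of the partial sums [y_i = x_1 + ... + x_i], the iterated integrals
   are compositions of the operators
     (S k m F)(c) = tail_op k m F c = \int_{y >= c + m} y^-k F(y) dy,
   and [zeta_m(1, ..., 1, 2)] is the value at 0 of
   [Phi m = S 1 m_1 (S 1 m_2 (... (1 / y)))].
   Consider the Q-span of the functions [Phi n] with [n] of weight [r], and
   [(c + a)^-e Phi n (c + a)] with [n] of weight [r - a], [a >= 1].  The operator
   [S k m] sends the span of weight [r] to that of weight [m + r]: partial
   fractions of [y^-j (y + a)^-e] together with
   [Phi n (y + a) = Phi (n_1 + a, n_2, ...) y] reduce to [S j m (Phi n)], and for
   [j >= 2] integration by parts (Tonelli) lowers [j], the boundary term being
   again of the second kind.  Evaluation at 0 gives (ii), and (iii) follows since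
   there are [2 ^ (r - 1)] compositions of [r].  Part (i) is the identity
     y^-p y^-1 = y^-(p+1) (y + 1)^-1 + y^-p (y + 1)^-1
   applied to the last variable. *)
From HB Require Import structures.
Require Import Defs.
From mathcomp Require Import all_boot all_order all_algebra.
From mathcomp Require Import all_classical all_reals all_analysis.
From mathcomp Require Import measurable_realfun ring.

Set Implicit Arguments.
Unset Strict Implicit.
Unset Printing Implicit Defensive.

Import Order.TTheory GRing.Theory Num.Theory.
Import numFieldNormedType.Exports.

Local Open Scope classical_set_scope.
Local Open Scope ring_scope.

(** * Tail integrals *)

Section tails.
Variable R : realType.
Local Notation RR := (measurableTypeR R).
Local Notation mu := (@lebesgue_measure R).
Implicit Types (f g F : R -> R) (c d x y z : R).

(** By uniqueness of Lebesgue measure it suffices to compare lengths of intervals []b, c]]. *)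
Lemma lebesgue_measure_shift (a : R) (A : set R) : measurable A ->
  pushforward mu ((fun x => x + a) : RR -> RR) A = mu A.
Proof.
move=> mA; apply/esym/lebesgue_measure_unique => //=.
  by apply: measurable_funD.
move=> mf _ [[b c]] _ <-.
rewrite /pushforward (_ : _ @^-1` _ = `]b - a, c - a]%classic); last first.
  by apply/seteqP; split=> x /=; rewrite !in_itv/= ltrBlDr lerBrDr.
rewrite !lebesgue_measure_itv/= !lte_fin ltrD2r -!EFinB.
by congr (if _ then _%:E else _); ring.
Qed.

Lemma ge0_integral_shift (a d : R) (f : R -> \bar R) :
  measurable_fun `[d + a, +oo[ f -> (forall x, d + a <= x -> (0 <= f x)%E) ->
  (\int[mu]_(x in `[d, +oo[) f (x + a)%R = \int[mu]_(x in `[(d + a)%R, +oo[) f x)%E.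
Proof.
move=> mf f0.
have mS : measurable_fun setT ((fun x => x + a) : RR -> RR).
  exact: measurable_funD.
pose s : RR -> RR := fun x => x + a.
transitivity (\int[pushforward mu s]_(x in `[(d + a)%R, +oo[) f x)%E; last first.
  apply: eq_measure_integral => A mA _; exact: lebesgue_measure_shift.
rewrite (ge0_integral_pushforward mS)//; last first.
  by move=> x; rewrite inE/= in_itv/= andbT; exact: f0.
rewrite (_ : _ @^-1` _ = `[d, +oo[%classic)//.
by apply/seteqP; split=> x /=; rewrite !in_itv/= !andbT lerD2r.
Qed.

Definition tail f d : R := \int[mu]_(x in `[d, +oo[) f x.

Lemma is_derive_inv_power (j : nat) (x : R) : x != 0 ->
  is_derive x 1 (fun y : R => y ^- j) (- (j%:R * x ^- j.+1)).
Proof.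
move=> x0; have x1 : (id ^+ j : R -> R) x != 0 by rewrite exprfctE expf_neq0.
rewrite (_ : (fun y : R => y ^- j) = fun y => ((id ^+ j : R -> R) y)^-1); last first.
  by apply/funext => y; rewrite exprfctE.
have h := is_deriveV x1 (is_deriveX j (is_derive_id x 1)).
rewrite [X in is_derive _ _ _ X](_ : _ =
    - (id ^+ j : R -> R) x ^- 2 *: (j%:R * x ^+ j.-1)%:A).
  exact: h.
rewrite exprfctE /GRing.scale/= mulr1; case: j {x1 h} => [|j].
  by rewrite !mul0r mulr0 oppr0.
have := expf_neq0 j x0; rewrite [j.+1.-1]/= !exprS; move: (x ^+ j) => u u0.
by field; rewrite x0 u0.
Qed.

Lemma integral_power_tail (j : nat) d : 0 < d ->
  (\int[mu]_(x in `[d, +oo[) ((x ^- j.+2)%:E) = (d ^- j.+1 / j.+1%:R)%:E)%E.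
Proof.
(* An antiderivative vanishing at infinity, so that only the boundary term at [d] survives. *)
move=> d0; pose F := - (j.+1%:R^-1 \*: (fun x : R => x ^- j.+1)).
have dF x : d <= x -> is_derive x 1 F (x ^- j.+2).
  move=> dx; have x0 : x != 0 by rewrite gt_eqF// (lt_le_trans d0).
  rewrite [X in is_derive _ _ _ X](_ : _ = - (j.+1%:R^-1 *: - (j.+1%:R * x ^- j.+2))).
    exact/is_deriveN/is_deriveZ/is_derive_inv_power.
  by rewrite /GRing.scale/= mulrN opprK mulrA mulVf ?mul1r ?pnatr_eq0.
rewrite (@ge0_continuous_FTC2y _ (fun x => x ^- j.+2) F d 0).
- by rewrite /F EFinN oppeK add0e mulrC.
- by move=> x dx; rewrite invr_ge0 exprn_ge0// (le_trans _ dx)// ltW.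
- apply: derivable_within_continuous => x; rewrite in_itv/= andbT => dx.
  have x0 : x != 0 by rewrite gt_eqF// (lt_le_trans d0).
  by have [] := is_derive_inv_power j.+2 x0.
- rewrite /F -[X in _ --> X]oppr0; apply: cvgN.
  rewrite -[X in _ --> X](mulr0 j.+1%:R^-1).
  apply: cvgMr.
  apply/gtr0_cvgV0.
    by apply: filterS (nbhs_pinfty_gt (num_real 0)) => x x0; rewrite exprn_gt0.
  apply/cvgryPge => A; near=> x.
  have x1 : 1 <= x by near: x; apply: nbhs_pinfty_ge; exact: num_real.
  apply: (@le_trans _ _ x); last by rewrite ler_eXnr.
  by near: x; apply: nbhs_pinfty_ge; exact: num_real.
- by move=> x /ltW /dF[].
- apply: cvg_at_right_filter.
  apply: differentiable_continuous; apply/derivable1_diffP.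
  by have [] := dF d (lexx _).
- move=> x; rewrite in_itv/= andbT => /ltW /dF h; rewrite derive1E.
  exact: derive_val.
Unshelve. all: by end_near.
Qed.

(* All the functions below are only controlled on [1, +oo[, where they are
   nonincreasing (hence measurable) with bound 1 in front of [x ^- p]. *)
Definition decays (p : nat) f :=
  (forall x y, 1 <= x -> x <= y -> f y <= f x) /\
  (forall x, 1 <= x -> 0 <= f x <= x ^- p).

Lemma decays_measurable p f d : 1 <= d -> decays p f ->
  measurable_fun `[d, +oo[ f.
Proof.
(* Freezing [f] at the value [f d] on the left of [d] gives a function that is nonincreasing on the
   whole line, hence measurable. *)
move=> d1 [fdec _]; pose g x := f (Num.max d x).
apply: (@eq_measurable_fun _ _ _ _ _ g).
  by move=> x; rewrite inE/= in_itv/= andbT /g => /max_idPr ->.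
apply: nonincreasing_measurable => // x y xy; apply: fdec.
  by rewrite le_max d1.
by rewrite ge_max !le_max lexx xy orbT.
Qed.

Lemma decays_leq p q f : (p <= q)%N -> decays q f -> decays p f.
Proof.
move=> pq [fdec fb]; split=> // x x1; have /andP[-> /le_trans -> //] := fb _ x1.
have x0 : 0 < x by apply: lt_le_trans x1.
by rewrite lef_pV2 ?posrE ?exprn_gt0// ler_weXn2l.
Qed.

Lemma decays_inv_power p : decays p (fun x => x ^- p).
Proof.
split=> [x y x1 xy|x x1].
  have x0 : 0 < x by apply: lt_le_trans x1.
  have y0 := lt_le_trans x0 xy.
  by rewrite lef_pV2 ?posrE ?exprn_gt0// lerXn2r// nnegrE ltW.
by rewrite lexx andbT invr_ge0 exprn_ge0// (le_trans _ x1).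
Qed.

Lemma decaysM p q f g : decays p f -> decays q g ->
  decays (p + q) (fun x => f x * g x).
Proof.
move=> [fd fb] [gd gb]; split=> [x y x1 xy|x x1].
  have y1 := le_trans x1 xy.
  have /andP[f0 _] := fb _ y1; have /andP[g0 _] := gb _ y1.
  by rewrite ler_pM ?fd ?gd.
have /andP[f0 f1] := fb _ x1; have /andP[g0 g1] := gb _ x1.
by rewrite mulr_ge0//= exprD invfM ler_pM.
Qed.

Lemma decays_shift p f (b : R) : 0 <= b -> decays p f -> decays p (fun x => f (x + b)).
Proof.
move=> b0 [fd fb]; split=> [x y x1 xy|x x1].
  by apply: fd; rewrite ?lerD2r// ler_wpDr.
have xb : 1 <= x + b by rewrite ler_wpDr.
have /andP[-> _] := fb _ xb.
rewrite (le_trans (fd _ _ x1 _)) ?lerDl//.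
by have /andP[] := fb _ x1.
Qed.

Lemma decays_integrable f d : 1 <= d -> decays 2 f ->
  mu.-integrable `[d, +oo[ (EFin \o f).
Proof.
move=> d1 fd; have d0 : 0 < d by apply: lt_le_trans d1.
apply: (@le_integrable _ RR R mu _ _ _ (EFin \o (fun x => x ^- 2))) => //.
- apply/measurable_EFinP; exact: decays_measurable fd.
- move=> x /=; rewrite in_itv/= andbT => dx.
  have /andP[f0 fx] := fd.2 _ (le_trans d1 dx).
  by rewrite lee_fin !ger0_norm ?(le_trans f0).
apply/integrableP; split.
  apply/measurable_EFinP; exact: decays_measurable (decays_inv_power 2).
rewrite (_ : integral _ _ _ = (\int[mu]_(x in `[d, +oo[) (x ^- 2)%:E)%E).
  by rewrite integral_power_tail// ltry.
apply: eq_integral.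
move=> x; rewrite inE/= in_itv/= andbT => dx.
by rewrite ger0_norm// invr_ge0 exprn_ge0// (le_trans (ltW d0)).
Qed.

(** Decay of order 2 makes the integral finite, so the [fine] hidden in [tail] loses nothing. *)
Lemma tailE f d : 1 <= d -> decays 2 f ->
  (tail f d)%:E = (\int[mu]_(x in `[d, +oo[) (f x)%:E)%E.
Proof.
move=> d1 fd; rewrite /tail /Rintegral fineK//.
by apply: integrable_fin_num => //; exact: decays_integrable.
Qed.

Lemma eq_tail f g d : (forall x, d <= x -> f x = g x) -> tail f d = tail g d.
Proof.
by move=> fg; apply: eq_Rintegral => x; rewrite inE/= in_itv/= andbT; exact: fg.
Qed.

Lemma tail_inv_power (j : nat) d : 0 < d ->
  tail (fun x => x ^- j.+2) d = d ^- j.+1 / j.+1%:R.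
Proof. by move=> d0; rewrite /tail /Rintegral integral_power_tail. Qed.

Lemma tail_shift f (a : R) d : 0 <= a -> 1 <= d -> decays 2 f ->
  tail (fun x => f (x + a)) d = tail f (d + a).
Proof.
move=> a0 d1 fd; rewrite /tail /Rintegral; congr fine.
have da : 1 <= d + a by rewrite ler_wpDr.
rewrite (@ge0_integral_shift a d (EFin \o f))//.
  by apply/measurable_EFinP; exact: decays_measurable fd.
move=> x dx; rewrite lee_fin.
by have /andP[] := fd.2 x (le_trans da dx).
Qed.

(** The domain of integration shrinks as [x] grows, and comparison with [z ^- 2] bounds the tail by
    [(x + b)^-1]. This is what allows tails to be iterated. *)
Lemma decays_tail f (b : R) : 0 <= b -> decays 2 f ->
  decays 1 (fun x => tail f (x + b)).
Proof.
move=> b0 fd; have fm (d : R) : 1 <= d -> measurable_fun `[d, +oo[ (EFin \o f).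
  by move=> d1; apply/measurable_EFinP; exact: decays_measurable fd.
have f0 (x : R) : 1 <= x -> 0 <= f x by case/fd.2/andP.
split=> [x y x1 xy|x x1].
  have xb : 1 <= x + b by rewrite ler_wpDr.
  have yb : x + b <= y + b by rewrite lerD2r.
  rewrite -lee_fin !tailE// ?(le_trans xb)//.
  apply: ge0_subset_integral => //=.
  - exact: fm.
  - by move=> z; rewrite in_itv/= andbT => /(le_trans xb)/f0; rewrite lee_fin.
  - by move=> z /=; rewrite !in_itv/= !andbT; exact: le_trans.
have xb : 1 <= x + b by rewrite ler_wpDr.
have x0 : 0 < x by apply: lt_le_trans x1.
apply/andP; split.
  apply: Rintegral_ge0 => z /=; rewrite in_itv/= andbT => /(le_trans xb).
  exact: f0.
apply: (@le_trans _ _ ((x + b) ^- 1)); last first.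
  by rewrite lef_pV2 ?posrE ?exprn_gt0 ?expr1 ?lerDl// (lt_le_trans _ xb).
rewrite -[leRHS]divr1 -tail_inv_power; last by apply: lt_le_trans xb.
rewrite -lee_fin !tailE//; last exact: (decays_inv_power 2).
apply: ge0_le_integral => //.
- by move=> z /=; rewrite in_itv/= andbT => /(le_trans xb)/f0; rewrite lee_fin.
- exact: fm.
- by apply/measurable_EFinP; exact: decays_measurable (decays_inv_power 2).
move=> z /=; rewrite in_itv/= andbT => /(le_trans xb)/fd.2/andP[_].
by rewrite lee_fin.
Qed.

(** Both sides integrate [g y * f z] over the region d <= y <= z. *)
Lemma tail_tonelli f g d : 1 <= d -> decays 2 f -> decays 2 g ->
  (\int[mu]_(y in `[d, +oo[) (g y * tail f y)%:E =
   \int[mu]_(z in `[d, +oo[) (f z * \int[mu]_(y in `[d, z]) g y)%:E)%E.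
Proof.
move=> d1 fd gd; pose D := `[d, +oo[%classic : set RR.
have DE x : (x \in D) = (d <= x) by rewrite /D mem_setE in_itv/= andbT.
have mD : measurable D by exact: measurable_itv.
have mf : measurable_fun D f by exact: decays_measurable fd.
have mg : measurable_fun D g by exact: decays_measurable gd.
have f0 x : d <= x -> 0 <= f x by move=> /(le_trans d1)/(fd.2 _)/andP[].
have g0 x : d <= x -> 0 <= g x by move=> /(le_trans d1)/(gd.2 _)/andP[].
(* The integrand, extended by 0 to the whole plane so that Tonelli applies. *)
pose k (p : RR * RR) : \bar R :=
  if p.1 <= p.2 then ((g \_ D) p.1 * (f \_ D) p.2)%:E else 0%E.
have mfD : measurable_fun setT (f \_ D) by exact: (measurable_restrictT f mD).1.
have mgD : measurable_fun setT (g \_ D) by exact: (measurable_restrictT g mD).1.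
have D0 (h : R -> R) x : (forall x, d <= x -> 0 <= h x) -> 0 <= (h \_ D) x.
  by move=> h0; rewrite patchE; case: ifPn => //; rewrite DE => /h0.
have mk : measurable_fun setT k.
  apply: measurable_fun_ifT => //.
    exact: (measurable_fun_ler measurable_fst measurable_snd).
  apply/measurable_EFinP/measurable_funM.
    exact: (measurableT_comp mgD measurable_fst).
  exact: (measurableT_comp mfD measurable_snd).
have k0 p : (0 <= k p)%E.
  by rewrite /k; case: ifP => // _; rewrite lee_fin mulr_ge0// D0.
have := @fubini_tonelli _ _ RR RR R mu mu k mk k0.
rewrite (_ : (\int[mu]_y \int[mu]_z k (y, z) =
    \int[mu]_(y in D) (g y * tail f y)%:E)%E); last first.
  rewrite [RHS]integral_mkcond; apply: eq_integral => y _; rewrite patchE.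
  case: ifPn => [|yD]; last first.
    rewrite integral0_eq// => z _; rewrite /k/= patchE (negbTE yD) mul0r.
    by case: ifP.
  rewrite DE => dy.
  rewrite EFinM tailE ?(le_trans d1)// -ge0_integralZl_EFin//; last 3 first.
  - by move=> z /=; rewrite in_itv/= andbT => /(le_trans dy)/f0; rewrite lee_fin.
  - apply/measurable_EFinP; apply: decays_measurable fd; exact: le_trans dy.
  - exact: g0.
  rewrite [RHS]integral_mkcond; apply: eq_integral => z _.
  rewrite /k/= !patchE (_ : (z \in `[y, +oo[%classic) = (y <= z)); last first.
    by rewrite mem_setE in_itv/= andbT.
  case: ifP => // yz; rewrite !DE dy (le_trans dy yz).
  by rewrite EFinM.
move=> ->; rewrite [RHS]integral_mkcond; apply: eq_integral => z _; rewrite patchE.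
case: ifPn => [|zD]; last first.
  rewrite integral0_eq// => y _; rewrite /k/= [X in _ * X]patchE (negbTE zD) mulr0.
  by case: ifP.
rewrite DE => dz.
have gz : mu.-integrable `[d, z] (EFin \o g).
  apply: integrableS (decays_integrable d1 gd) => //.
  by move=> y /=; rewrite !in_itv/= andbT => /andP[].
rewrite EFinM /Rintegral fineK ?integrable_fin_num// -integralZl//.
rewrite [RHS]integral_mkcond; apply: eq_integral => y _.
rewrite /k/= !patchE !DE mem_setE in_itv/=.
by case: ifP => yz; case: (leP d y) => dy //; rewrite ?mul0r// dz EFinM muleC.
Qed.

Lemma integrable_lincomb (a b : R) f g (D : set RR) : measurable D ->
  mu.-integrable D (EFin \o f) -> mu.-integrable D (EFin \o g) ->
  mu.-integrable D (EFin \o (fun x => a * f x + b * g x)).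
Proof.
move=> mD fi gi.
exact: (integrableD mD (integrableZl mD a fi) (integrableZl mD b gi)).
Qed.

Lemma tail_lincomb (a b : R) f g d : mu.-integrable `[d, +oo[ (EFin \o f) ->
  mu.-integrable `[d, +oo[ (EFin \o g) ->
  tail (fun x => a * f x + b * g x) d = a * tail f d + b * tail g d.
Proof.
move=> fi gi; have mD : measurable (`[d, +oo[%classic : set RR) by [].
rewrite /tail RintegralD// ?RintegralZl//.
  exact: (integrableZl mD a fi).
exact: (integrableZl mD b gi).
Qed.

(** Exchanging the integrals leaves the explicit inner integral of [y ^- j.+2] over [d, z]. Since
    [f] is only known to be monotone, this replaces differentiation of [tail f]. *)
Lemma tail_by_parts (j : nat) f d : 1 <= d -> decays 2 f ->
  tail (fun y => y ^- j.+2 * tail f y) d =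
  j.+1%:R^-1 * (d ^- j.+1 * tail f d - tail (fun y => y ^- j.+1 * f y) d).
Proof.
move=> d1 fd; pose g x : R := x ^- j.+2.
have gd : decays 2 g by apply: (@decays_leq 2 j.+2 g) => //; exact: decays_inv_power.
have fi := decays_integrable d1 fd.
have gi := decays_integrable d1 gd.
have d0 : 0 < d by apply: lt_le_trans d1.
have gfd : decays 2 (fun x => x ^- j.+1 * f x).
  apply: (@decays_leq 2 (j.+1 + 2)); first by rewrite addn2.
  exact: decaysM (decays_inv_power _) fd.
have gfi := decays_integrable d1 gfd.
transitivity (tail (fun z => f z * \int[mu]_(y in `[d, z]) g y) d).
  by rewrite /tail /Rintegral tail_tonelli.
transitivity (tail (fun z => (j.+1%:R^-1 * d ^- j.+1) * f z +
                             (- j.+1%:R^-1) * (z ^- j.+1 * f z)) d).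
  apply: eq_tail => z dz.
  have z0 : 0 < z by apply: lt_le_trans dz.
  (* The integral over [d, z] is a difference of two tails, both known from [tail_inv_power]. *)
  have : tail g d - \int[mu]_(y in `[d, z]) g y = tail g z.
    rewrite [LHS]Rintegral_itvB//= ?bnd_simp//.
    rewrite Rintegral_itv_obnd_cbnd//.
apply: integrableS gi => //.
    by move=> y /=; rewrite !in_itv/= !andbT => /ltW; exact: le_trans.
  rewrite /g !tail_inv_power// => /eqP; rewrite subr_eq addrC -subr_eq => /eqP <-.
  by ring.
rewrite tail_lincomb//; ring.
Qed.

(** * Reduction to the exponents (1, ..., 1, 2) *)

Definition tail_op (k m : nat) F c := tail (fun y => y ^- k * F y) (c + m%:R).

(* Starting from [1 / y] turns the last exponent 1 into 2. *)
Fixpoint Phi (n : seq nat) : R -> R :=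
  if n is b :: n' then tail_op 1 b (Phi n') else fun y => y^-1.

Lemma decays_tail_op k m F : decays 2 (fun y => y ^- k * F y) ->
  decays 1 (tail_op k m F).
Proof. by move=> Fd; exact: decays_tail. Qed.

Lemma decays_Phi n : decays 1 (Phi n).
Proof.
elim: n => [|b n ih]; first exact: (decays_inv_power 1).
by apply: decays_tail_op; exact: (decaysM (decays_inv_power 1) ih).
Qed.

Lemma eq_tail_op k m F G c : (1 <= m)%N -> 0 <= c ->
  (forall y, 1 <= y -> F y = G y) -> tail_op k m F c = tail_op k m G c.
Proof.
move=> m1 c0 FG; apply: eq_tail => y cy; rewrite FG// (le_trans _ cy)//.
by rewrite ler_wpDl// ler1n.
Qed.

(** The value [[:: a]] on the empty sequence matches [Phi [:: a] y = (y + a)^-1], so that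
    [Phi_add_head] holds for all sequences. *)
Definition add_head (a : nat) (n : seq nat) :=
  if n is b :: n' then (b + a)%N :: n' else [:: a].

Lemma sumn_add_head a n : sumn (add_head a n) = (sumn n + a)%N.
Proof. by case: n => [|b n] /=; [rewrite addnC | rewrite addnAC]. Qed.

Lemma all_add_head a n : (1 <= a)%N -> all (leq 1) n -> all (leq 1) (add_head a n).
Proof.
case: n => [|b n] /=; first by move=> ->.
by move=> _ /andP[b1 ->]; rewrite ltn_addr.
Qed.

(** Translating the argument only moves the lower limit of the outermost tail. *)
Lemma Phi_add_head a n y : 0 < y + a%:R -> Phi (add_head a n) y = Phi n (y + a%:R).
Proof.
move=> ya; case: n => [|b n] /=; last by rewrite /tail_op natrD addrCA addrC.
rewrite /tail_op (@eq_tail _ (fun x => x ^- 2)) ?tail_inv_power ?divr1//.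
by move=> x _; rewrite -invfM -exprSr.
Qed.

(* Membership in the Q-span described at the top of the file, for functions
   considered up to equality on [0, +oo[. *)
Inductive Gspan (r : nat) : (R -> R) -> Prop :=
| Gspan_Phi n : n != [::] -> all (leq 1) n -> sumn n = r -> Gspan r (Phi n)
| Gspan_shift a e n : (1 <= a)%N -> all (leq 1) n -> (sumn n + a = r)%N ->
    Gspan r (fun c => (c + a%:R) ^- e * Phi n (c + a%:R))
| Gspan0 : Gspan r (fun=> 0)
| Gspan_add q F G : Gspan r F -> Gspan r G -> Gspan r (fun c => ratr q * F c + G c)
| Gspan_ext F G : (forall c, 0 <= c -> F c = G c) -> Gspan r F -> Gspan r G.

Lemma Gspan_lincomb r (p q : rat) F G : Gspan r F -> Gspan r G ->
  Gspan r (fun c => ratr p * F c + ratr q * G c).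
Proof.
move=> HF HG; apply: Gspan_add => //.
apply: (@Gspan_ext r (fun c => ratr q * G c + 0)); first by move=> c _; rewrite addr0.
exact: Gspan_add HG (Gspan0 r).
Qed.

Lemma decays_shifted_Phi a e n :
  decays e.+1 (fun c => (c + a%:R) ^- e * Phi n (c + a%:R)).
Proof.
rewrite -addn1; apply: decaysM.
  exact: (decays_shift (ler0n _ _) (decays_inv_power e)).
exact: (decays_shift (ler0n _ _) (decays_Phi n)).
Qed.

(** Combinations with negative coefficients need not satisfy [decays], so integrability, which makes
    [tail] linear, is propagated from the generators. *)
Lemma Gspan_integrable r F k d : (1 <= k)%N -> 1 <= d -> Gspan r F ->
  mu.-integrable `[d, +oo[ (EFin \o (fun y => y ^- k * F y)).
Proof.
move=> k1 d1.
have decays1 G : decays 1 G ->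
    mu.-integrable `[d, +oo[ (EFin \o (fun y => y ^- k * G y)).
  move=> Gd; apply: decays_integrable d1 _.
  by apply: (decays_leq _ (decaysM (decays_inv_power k) Gd)); rewrite addn1.
elim=> [n _ _ _|a e n _ _ _||q G H _ iG _ iH|G H GH _ iG].
- exact/decays1/decays_Phi.
- by apply: decays1; apply: decays_leq (decays_shifted_Phi a e n).
- by apply: decays1; split=> // x x1; rewrite lexx/= invr_ge0 expr1 (le_trans _ x1).
- apply: eq_integrable (integrable_lincomb (ratr q) 1 _ iG iH) => //.
  by move=> x _ /=; congr EFin; ring.
- apply: eq_integrable iG => // x; rewrite inE/= in_itv/= andbT => dx.
  by rewrite /= GH// (le_trans _ dx)// (le_trans _ d1).
Qed.

Lemma tail_op_Phi_nil j m c : (1 <= m)%N -> 0 <= c ->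
  tail_op j.+1 m (Phi [::]) c = j.+1%:R^-1 * ((c + m%:R) ^- j * Phi [::] (c + m%:R)).
Proof.
move=> m1 c0; rewrite /tail_op (@eq_tail _ (fun x => x ^- j.+2)); last first.
  by move=> x _; rewrite /= -invfM -?exprSr -?exprS.
rewrite tail_inv_power/=; last by rewrite ltr_wpDl// ltr0n.
by rewrite mulrC exprSr invfM.
Qed.

Lemma ratr_inv (j : nat) : ratr j%:R^-1 = j%:R^-1 :> R.
Proof. by rewrite fmorphV/= ratr_nat. Qed.

Lemma Gspan_tail_op_Phi_nil j m : (1 <= j)%N -> (1 <= m)%N ->
  Gspan m (tail_op j m (Phi [::])).
Proof.
case: j => // j _ m1.
have H := @Gspan_shift m m j [::] m1 isT erefl.
apply: Gspan_ext (Gspan_add j.+1%:R^-1 H (Gspan0 m)) => c c0.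
by rewrite tail_op_Phi_nil// addr0 ratr_inv.
Qed.

(** For j = 1 the result is [Phi (m :: b :: n)]. For j = i + 2, integration by parts yields a
    boundary term, which is a shifted generator, and the integral assumed to be in the span. *)
Lemma Gspan_tail_op_Phi_cons j m b n : (1 <= j)%N -> (1 <= m)%N ->
    all (leq 1) (b :: n) ->
    (forall i, j = i.+2 -> Gspan (m + b + sumn n)
      (tail_op i.+1 m (fun y => (y + b%:R) ^- 1 * Phi n (y + b%:R)))) ->
  Gspan (m + b + sumn n) (tail_op j m (Phi (b :: n))).
Proof.
move=> j1 m1 bn H.
case: j j1 H => // -[_ _|i _ /(_ _ erefl) H].
  by apply: (@Gspan_Phi _ (m :: b :: n)); rewrite //= ?m1// addnA.
have H1 := @Gspan_shift (m + b + sumn n) m i.+1 (b :: n) m1 bn _.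
apply: Gspan_ext (Gspan_lincomb i.+1%:R^-1 (- i.+1%:R^-1) (H1 _) H); last first.
  by rewrite /= addnC addnA.
move=> c c0; rewrite rmorphN/= ratr_inv mulNr -mulrBr.
have cm : 1 <= c + m%:R by rewrite ler_wpDl// ler1n.
pose f z : R := z ^- 1 * Phi n z.
have fd : decays 2 f by exact: decaysM (decays_inv_power 1) (decays_Phi n).
(* Moving the shift by [b] into the integrand makes the inner tail start at [y] itself, as
   [tail_by_parts] requires. *)
pose g z : R := f (z + b%:R).
have gd : decays 2 g by exact: decays_shift.
have E y : 1 <= y -> tail_op 1 b (Phi n) y = tail g y.
  by move=> y1; rewrite /g tail_shift.
by rewrite E// [RHS](@eq_tail_op _ _ _ (tail g))// /tail_op tail_by_parts.
Qed.

Lemma tail_op0_shift e m a n c : (1 <= e)%N -> (1 <= m)%N -> 0 <= c ->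
  tail_op 0 m (fun y => (y + a%:R) ^- e * Phi n (y + a%:R)) c =
  tail_op e (m + a) (Phi n) c.
Proof.
move=> e1 m1 c0; rewrite /tail_op.
rewrite (@eq_tail _ (fun y => (y + a%:R) ^- e * Phi n (y + a%:R))); last first.
  by move=> y _; rewrite expr0 invr1 mul1r.
rewrite (@tail_shift (fun y => y ^- e * Phi n y))//.
- by rewrite natrD addrA.
- by rewrite ler_wpDl// ler1n.
by apply: (decays_leq _ (decaysM (decays_inv_power e) (decays_Phi n))); rewrite addn1.
Qed.

(** From 1 / (y (y + a)) = (1 / y - 1 / (y + a)) / a; each term on the right has total exponent one
    less. *)
Lemma tail_op_partial_fraction j e a m n c : (1 <= m)%N -> (1 <= a)%N -> 0 <= c ->
  let f e y := (y + a%:R) ^- e * Phi n (y + a%:R) in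
  tail_op j.+1 m (f e.+1) c =
    a%:R^-1 * tail_op j.+1 m (f e) c - a%:R^-1 * tail_op j m (f e.+1) c.
Proof.
move=> m1 a1 c0 f; have cm : 1 <= c + m%:R by rewrite ler_wpDl// ler1n.
have int i e' : (1 <= i + e')%N ->
    mu.-integrable `[c + m%:R, +oo[ (EFin \o (fun y => y ^- i * f e' y)).
  move=> ie; apply: decays_integrable cm _.
  have := decaysM (decays_inv_power i) (decays_shifted_Phi a e' n).
  by apply: decays_leq; rewrite addnS.
rewrite -mulNr -tail_lincomb; last 2 first.
- exact: int.
- by apply: int; rewrite addnS.
apply: eq_tail => y cy; have y0 : 0 < y by rewrite (lt_le_trans _ (le_trans cm cy)).
have a0 : 0 < a%:R :> R by rewrite ltr0n.
rewrite /f !exprS; have := addr_gt0 y0 a0.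
have /lt0r_neq0 := exprn_gt0 j y0.
have /lt0r_neq0 := exprn_gt0 e (addr_gt0 y0 a0).
move: (Phi n _) (y ^+ j) ((y + a%:R) ^+ e) => P u v v0 u0 ya.
by field; rewrite u0 v0 !gt_eqF.
Qed.

(* For [n = [::]], integrating by parts against [Phi (add_head a n)] leads back
   to the statement for [n] itself with [e = 1], whence the induction on [j + e]
   in which the case [e = 0] comes last. *)
Lemma Gspan_tail_op_shift_step n :
    (forall j m, (1 <= j)%N -> (1 <= m)%N ->
      Gspan (m + sumn n) (tail_op j m (Phi n))) ->
    (forall j a m, (1 <= j)%N -> (1 <= a)%N -> (1 <= m)%N ->
      (forall i, j = i.+2 -> Gspan (m + a + sumn n)
         (tail_op i.+1 m (fun y => (y + a%:R) ^- 1 * Phi n (y + a%:R)))) ->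
      Gspan (m + a + sumn n) (tail_op j m (Phi (add_head a n)))) ->
  forall j e a m, (1 <= j + e)%N -> (1 <= a)%N -> (1 <= m)%N ->
  Gspan (m + a + sumn n)
    (tail_op j m (fun y => (y + a%:R) ^- e * Phi n (y + a%:R))).
Proof.
move=> HA H0 j e a m + a1 m1; move: {2}(j + e)%N (erefl (j + e)%N) => s.
elim: s j e => [|s ih] j e jes; rewrite jes// => _.
(* Here the shifted factor has a positive exponent: for i = 0 a translation concludes, otherwise
   partial fractions lower the total exponent. *)
have pos i k : (i + k = s.+1)%N -> (1 <= k)%N -> Gspan (m + a + sumn n)
    (tail_op i m (fun y => (y + a%:R) ^- k * Phi n (y + a%:R))).
  case: i k => [|i] [|k] // iks _.
    apply: Gspan_ext (HA k.+1 (m + a)%N _ _) => //; last by rewrite ltn_addr.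
    by move=> c c0; rewrite tail_op0_shift.
  have H1 : Gspan (m + a + sumn n)
    (tail_op i.+1 m (fun y => (y + a%:R) ^- k * Phi n (y + a%:R))).
    by apply: ih; move: iks; rewrite addSn addnS => -[].
  have H2 : Gspan (m + a + sumn n)
    (tail_op i m (fun y => (y + a%:R) ^- k.+1 * Phi n (y + a%:R))).
    by apply: ih; rewrite ?addnS//; move: iks; rewrite addSn addnS => -[].
  apply: Gspan_ext (Gspan_lincomb a%:R^-1 (- a%:R^-1) H1 H2) => c c0.
  by rewrite tail_op_partial_fraction// rmorphN/= ratr_inv mulNr.
case: e jes => [|e jes]; last exact: pos.
(* The exponents produced by integration by parts are j - 1 and 1, with the same sum j, so [pos]
   covers them although the induction hypothesis does not. *)
rewrite addn0 => js; apply: Gspan_ext (H0 j a m _ a1 m1 _) => [c c0||i ji].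
- apply: eq_tail_op => // y y1; rewrite expr0 invr1 mul1r Phi_add_head//.
  by rewrite ltr_wpDr// (lt_le_trans _ y1).
- by rewrite js.
- by apply: pos => //; rewrite -js ji addn1.
Qed.

(** Induction on [n]: for [b :: n], integration by parts removes the head and leaves an instance for
    [n]. *)
Lemma Gspan_tail_op_shift n j e a m : all (leq 1) n -> (1 <= j + e)%N ->
    (1 <= a)%N -> (1 <= m)%N ->
  Gspan (m + a + sumn n)
    (tail_op j m (fun y => (y + a%:R) ^- e * Phi n (y + a%:R))).
Proof.
elim: n j e a m => [|b n ih] j e a m nP je a1 m1.
  apply: Gspan_tail_op_shift_step => // [j' m' j1 m1'|j' a' m' j1 a1' m1' H].
    by rewrite addn0; exact: Gspan_tail_op_Phi_nil.
  by apply: Gspan_tail_op_Phi_cons => //=; rewrite a1'.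
have /andP[b1 n1] := nP.
apply: Gspan_tail_op_shift_step => // [j' m' j1 m1'|j' a' m' j1 a1' m1' H].
  rewrite addnA; apply: Gspan_tail_op_Phi_cons => // i _; exact: ih.
rewrite (_ : (m' + a' + sumn (b :: n) = m' + (b + a') + sumn n)%N); last first.
  by rewrite /= addnA (addnC b) !addnA.
apply: Gspan_tail_op_Phi_cons => //=; first by rewrite ltn_addr.
by move=> i _; apply: ih => //; rewrite ltn_addr.
Qed.

Lemma Gspan_tail_op_Phi n j m : all (leq 1) n -> (1 <= j)%N -> (1 <= m)%N ->
  Gspan (m + sumn n) (tail_op j m (Phi n)).
Proof.
case: n => [|b n] nP j1 m1; first by rewrite addn0; exact: Gspan_tail_op_Phi_nil.
have /andP[b1 n1] := nP.
by rewrite addnA; apply: Gspan_tail_op_Phi_cons => // i _; exact: Gspan_tail_op_shift.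
Qed.

Lemma Gspan_tail_op r F k m : (1 <= k)%N -> (1 <= m)%N -> Gspan r F ->
  Gspan (m + r) (tail_op k m F).
Proof.
move=> k1 m1; elim=> [n _ nP <-|a e n a1 nP <-||q G H GG iG GH iH|G H GH _ iG].
- exact: Gspan_tail_op_Phi.
- by rewrite (addnC _ a) addnA; apply: Gspan_tail_op_shift => //; rewrite ltn_addr.
- apply: Gspan_ext (Gspan0 _) => c c0; rewrite /tail_op (@eq_tail _ (fun=> 0)).
    by rewrite /tail /Rintegral integral0.
  by move=> y _; rewrite mulr0.
- apply: Gspan_ext (Gspan_add q iG iH) => c c0.
  have cm : 1 <= c + m%:R by rewrite ler_wpDl// ler1n.
  rewrite -[X in _ + X]mul1r -tail_lincomb; last 2 first.
  + exact: Gspan_integrable GG.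
  + exact: Gspan_integrable GH.
  by apply: eq_tail => y _; ring.
- apply: Gspan_ext iG => c c0; apply: eq_tail_op => // y y1; apply: GH.
  exact: le_trans y1.
Qed.

End tails.

(** * Multiple integrals as iterated tails *)

Section lebesgue_tuple_tonelli.
Variable R : realType.
Local Notation RR := (measurableTypeR R).
Local Notation mu := (@lebesgue_measure R).

Lemma product_snoc_setX n (m : {measure set (n.-tuple RR) -> \bar R})
    (A : set (n.-tuple RR)) (B : set RR) (C : set (n.+1.-tuple RR)) :
  measurable A -> measurable B ->
  (forall p : n.-tuple RR * RR, C (tuple_snoc p) <-> A p.1 /\ B p.2) ->
  (product_snoc m C = m A * mu B)%E.
Proof.
move=> mA mB CAB; rewrite /product_snoc /pushforward -product_measure1E//.
by congr (_ _); apply/seteqP; split=> p /CAB.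
Qed.

(** The cubes [-k, k]^n exhaust the space. Tonelli needs this, and the type of [lebesgue_tuple]
    records only a measure. *)
Lemma lebesgue_tuple_sigma_finite n : sigma_finite setT (lebesgue_tuple R n).
Proof.
pose box n k := [set t : n.-tuple RR | forall i, tnth t i \in `[- k%:R, k%:R]].
have mbox p k : measurable (box p k).
  rewrite (_ : box p k = \bigcap_(i in setT)
      ((fun t : p.-tuple RR => tnth t i) @^-1` `[- k%:R, k%:R])).
    apply: fin_bigcap_measurable => // i _.
    rewrite -[X in measurable X]setTI; apply: measurable_tnth => //.
  by apply/seteqP; split=> t tk i //=; apply: tk.
exists (box n).
  apply/esym/seteqP; split=> // t _.
  pose M := \sum_(i < n) `|tnth t i|.
  exists (Num.bound M) => //= i.
  rewrite in_itv/= -ler_norml (le_trans _ (ltW (archi_boundP _)))//.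
    by rewrite /M (bigD1 i)//= lerDl sumr_ge0.
  by rewrite sumr_ge0.
move=> k; split; first exact: mbox.
elim: n => [|n ih] /=.
  by rewrite diracE; case: (_ \in _); rewrite ltry.
rewrite (@product_snoc_setX _ _ (box n k) `[- k%:R, k%:R]%classic)//.
  rewrite lte_mul_pinfty ?ge0_fin_numE//.
  by rewrite lebesgue_measure_itv/=; case: ifP => _ //; rewrite -EFinD ltry.
move=> [t x]; split=> /= [h|[h1 h2] i].
  split=> [i|].
    have := h (widen_ord (leqnSn n) i).
    by rewrite !(tnth_nth 0)/= nth_rcons size_tuple ltn_ord.
  by have := h ord_max; rewrite (tnth_nth 0)/= nth_rcons size_tuple ltnn eqxx.
rewrite (tnth_nth 0)/= nth_rcons size_tuple.
case: ltnP => [ilt|ige]; first by have := h1 (Ordinal ilt); rewrite (tnth_nth 0).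
by rewrite eqn_leq ige -ltnS ltn_ord.
Qed.

Lemma integral_lebesgue_tupleS n (f : n.+1.-tuple RR -> \bar R) :
  measurable_fun setT f -> (forall t, 0 <= f t)%E ->
  (\int[lebesgue_tuple R n.+1]_t f t =
   \int[lebesgue_tuple R n]_t \int[mu]_x f (tuple_snoc (t, x)))%E.
Proof.
move=> mf f0.
pose m := lebesgue_tuple R n.
have m_sigma_finite := lebesgue_tuple_sigma_finite n.
pose sf := isSFinite.Build _ _ _ _ (sfinite_measure_sigma_finite m_sigma_finite).
pose sigf := isSigmaFinite.Build _ _ _ _ m_sigma_finite.
pose m' : {sigma_finite_measure set (n.-tuple RR) -> \bar R} :=
  HB.pack_for (SigmaFiniteMeasure.type (n.-tuple RR) R) (Measure.sort m) sf sigf.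
have ms := @measurable_tuple_snoc R n.
transitivity (\int[m \x mu]_p f (tuple_snoc p))%E.
  rewrite -[RHS](@ge0_integral_pushforward _ _ _ _ _ _ ms (m \x mu)%E setT)//.
apply: (@fubini_tonelli1 _ _ _ _ _ m' mu (f \o @tuple_snoc R n)) => //.
  exact: measurableT_comp.
by move=> p; exact: f0.
Qed.
End lebesgue_tuple_tonelli.

(** * Zeta values as values at 0 of iterated tail operators *)

Section multiple_integrals_as_tails.
Variable R : realType.
Local Notation RR := (measurableTypeR R).
Local Notation mu := (@lebesgue_measure R).

(** For the induction, [c] is the sum of the outer variables already fixed and [q] the factor they
    contribute. The separate last factor raises the final exponent to 2. *)
Lemma iterated_integral_Phi (m : seq nat) (q c : R) : all (leq 1) m ->
    0 <= q -> 0 <= c ->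
  iterated_integral m (fun x => (q * ((\prod_(i < size m) (c + \sum_(j < i.+1) x`_j))^-1
    * (c + \sum_(j < size m) x`_j)^-1))%:E) = (q * Phi m c)%:E.
Proof.
elim: m q c => [|b m ih] q c /=.
  by move=> _ _ _; rewrite !big_ord0 addr0 invr1 mul1r.
move=> /andP[b1 m1] q0 c0.
have cb : 1 <= c + b%:R by rewrite ler_wpDl// ler1n.
pose f y : R := y ^- 1 * Phi m y.
have fd : decays 2 f by exact: decaysM (decays_inv_power _ 1) (decays_Phi _ m).
transitivity (\int[mu]_(x in `[b%:R, +oo[) (q%:E * (f (x + c))%:E)%E)%E.
  apply: eq_integral => x; rewrite inE/= in_itv/= andbT => bx.
  have x0 : 0 <= x by apply: le_trans bx.
  rewrite -EFinM (addrC x) /f mulrA -ih ?addr_ge0//; last first.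
    by rewrite mulr_ge0// expr1 invr_ge0 addr_ge0.
  congr iterated_integral; apply/funext => s; congr EFin.
  rewrite big_ord_recl big_ord1/= [in X in (c + X)^-1]big_ord_recl/= addrA.
  rewrite invfM -!mulrA; congr (_ * (_ * (_^-1 * _))).
  by apply: eq_bigr => i _; rewrite big_ord_recl/= addrA.
have gd : decays 2 (fun x => f (x + c)) by exact: decays_shift.
have b1' : 1 <= b%:R :> R by rewrite ler1n.
rewrite ge0_integralZl_EFin//; last 2 first.
- by move=> x /=; rewrite in_itv/= andbT lee_fin => /(le_trans b1')/(gd.2 _)/andP[].
- by apply/measurable_EFinP; exact: decays_measurable gd.
by rewrite -tailE// tail_shift// addrC.
Qed.

Lemma czeta12_Phi (m : seq nat) : m != [::] -> all (leq 1) m ->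
  czeta12 R m = Phi m 0.
Proof.
move=> m0 m1; rewrite /czeta12 -[Phi m 0]mul1r.
rewrite -[RHS]/(fine (1 * Phi m 0)%:E) -iterated_integral_Phi//.
congr (fine (iterated_integral m _)); apply/funext => x; congr EFin.
case: m m0 m1 => // b m _ _; rewrite /czeta_integrand size_rcons size_nseq /=.
rewrite mul1r -invfM !big_ord_recr/=.
rewrite !add0r nth_rcons size_nseq ltnn eqxx expr2 mulrA.
congr ((_ * _ * _)^-1); apply: eq_bigr => i _.
by rewrite nth_rcons size_nseq ltn_ord nth_nseq ltn_ord expr1 add0r.
Qed.

Lemma czeta_integrand_rcons (k : seq nat) (a : nat) (x : seq R) :
  czeta_integrand (rcons k a) x =
  czeta_integrand k x * (\sum_(j < (size k).+1) x`_j) ^- a.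
Proof.
rewrite /czeta_integrand size_rcons big_ord_recr/= invfM.
rewrite nth_rcons ltnn eqxx; congr (_^-1 * _).
by apply: eq_bigr => i _; rewrite nth_rcons ltn_ord.
Qed.

Lemma eq_czeta_integrand (k : seq nat) (x y : seq R) :
  (forall i, (i < size k)%N -> x`_i = y`_i) ->
  czeta_integrand k x = czeta_integrand k y.
Proof.
move=> xy; congr (_^-1); apply: eq_bigr => i _; congr (_ ^+ _).
by apply: eq_bigr => j _; rewrite xy// (leq_trans (ltn_ord j)).
Qed.

Let box n := [set t : n.-tuple RR | forall i, 1 <= tnth t i].
Arguments box : clear implicits.

Let measurable_box n : measurable (box n).
Proof.
rewrite (_ : box n = \bigcap_(i in setT)
    ((fun t : n.-tuple RR => tnth t i) @^-1` `[1, +oo[)).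
  apply: fin_bigcap_measurable => // i _.
  by rewrite -[X in measurable X]setTI; apply: measurable_tnth.
apply/seteqP; split=> [t tk i _|t tk i] /=.
  by rewrite in_itv/= andbT; exact: tk.
by have := tk i I; rewrite /= in_itv/= andbT.
Qed.

Let sum_ge1 n (t : n.-tuple RR) i : box n t -> (0 < i <= n)%N -> 1 <= \sum_(j < i) t`_j.
Proof.
move=> tb; case: i => // i /= ile; rewrite big_ord_recl/=.
have t1 j : (j < n)%N -> 1 <= t`_j.
  by move=> jn; have := tb (Ordinal jn); rewrite (tnth_nth 0).
apply: le_trans (t1 0 _) _ => //; first exact: leq_ltn_trans ile.
rewrite lerDl sumr_ge0// => j _; apply: le_trans (t1 _ _) => //.
by rewrite /= (leq_ltn_trans _ ile)// /bump /= add1n.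
Qed.

Let measurable_sum_nth n i :
  measurable_fun setT (fun t : n.-tuple RR => \sum_(j < i) t`_j).
Proof.
apply: measurable_sum => j; have [jn|nj] := ltnP j n.
  rewrite (_ : (fun _ => _) = fun t : n.-tuple RR => tnth t (Ordinal jn)).
    exact: measurable_tnth.
  by apply/funext => t; rewrite (tnth_nth 0).
rewrite (_ : (fun _ => _) = cst 0) //.
by apply/funext => t; rewrite nth_default// size_tuple.
Qed.

Lemma measurable_decays_comp d (T : measurableType d) (D : set T) (g : T -> R)
    p (F : R -> R) :
  (forall t, D t -> 1 <= g t) -> measurable_fun D g -> decays p F ->
  measurable_fun D (fun t => F (g t)).
Proof.
move=> g1 mg Fd.
apply: (@measurable_comp _ _ _ T RR RR `[1, +oo[%classic F D g) => //.
- by move=> _ [t tD <-] /=; rewrite in_itv/= andbT g1.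
- exact: decays_measurable Fd.
Qed.

Let measurable_integrand n (k : seq nat) F : size k = n.+1 -> decays 1 F ->
  measurable_fun (box n.+1)
    (fun t => czeta_integrand k t * F (\sum_(j < n.+1) t`_j)).
Proof.
move=> kn Fd; apply: measurable_funM.
  pose P (t : n.+1.-tuple RR) : R :=
    \prod_(i < size k) (\sum_(j < i.+1) t`_j) ^+ nth 0%N k i.
  (* On the box every partial sum is at least 1, hence so is the product [P]. *)
  apply: (@measurable_decays_comp _ _ _ P 1 (fun y => y ^- 1)).
  - move=> t tb; rewrite /P.
    elim/big_ind: _ => // [x y x1 y1|i _]; first exact: mulr_ege1.
    by rewrite exprn_ege1// sum_ge1//= -kn.
  - apply: measurable_funTS; apply: measurable_prod => i _.
    by apply: measurable_funX; exact: measurable_sum_nth.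
  - exact: decays_inv_power.
apply: measurable_decays_comp Fd => [t tb|]; first by apply: sum_ge1 => //=.
by apply: measurable_funTS; exact: measurable_sum_nth.
Qed.

(** The weight [F] of the total sum makes the induction work: integrating out the last variable
    replaces [F] by [tail_op a 1 F], a weight of the sum of the remaining ones. *)
Lemma integral_lebesgue_tuple_tail_op n (k : seq nat) (F : R -> R) :
    size k = n -> all (leq 1) k -> decays 1 F ->
  (\int[lebesgue_tuple R n]_(t in box n)
     (czeta_integrand k t * F (\sum_(j < n) t`_j))%:E =
   (foldr (fun a => tail_op a 1) F k 0)%:E)%E.
Proof.
elim: n k F => [|n ih] k F.
  move=> /size0nil -> _ _ /=.
  rewrite (eq_integral (cst (F 0)%:E)); last first.
    by move=> t _; rewrite /czeta_integrand !big_ord0 invr1 mul1r.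
  rewrite integral_dirac ?diracE; last exact: measurable_cst.
    by rewrite mem_set ?mul1e// => -[].
  exact: measurable_box.
case/lastP: k => // k a; rewrite size_rcons all_rcons => -[kn] /andP[a1 k1] Fd.
pose f (t : n.+1.-tuple RR) := czeta_integrand (rcons k a) t * F (\sum_(j < n.+1) t`_j).
have fi0 : forall m (k : seq nat) (t : m.-tuple RR), size k = m -> box m t ->
    0 <= czeta_integrand k t.
  move=> m k' t km tb; rewrite invr_ge0 prodr_ge0// => i _.
  by rewrite exprn_ge0// (le_trans ler01)// (sum_ge1 tb)//= -km.
have f0 t : box n.+1 t -> 0 <= f t.
  move=> tb; rewrite mulr_ge0 ?fi0 ?size_rcons ?kn//.
  by have /(Fd.2 _)/andP[] := @sum_ge1 _ t n.+1 tb (leqnn _).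
have mf : measurable_fun (box n.+1) f.
  by apply: measurable_integrand => //; rewrite size_rcons kn.
have hd : decays 2 (fun y => y ^- a * F y).
  by apply: (decays_leq _ (decaysM (decays_inv_power _ a) Fd)); rewrite addn1.
rewrite integral_mkcond integral_lebesgue_tupleS; first last.
- move=> t; rewrite patchE; case: ifPn => // /set_mem tb; rewrite lee_fin; exact: f0.
- apply: (measurable_restrictT (EFin \o f) (@measurable_box n.+1)).1.
  exact/measurable_EFinP.
rewrite foldr_rcons -ih//; last exact: decays_tail_op.
rewrite [RHS]integral_mkcond; apply: eq_integral => t _; rewrite patchE.
pose S := \sum_(j < n) t`_j.
have boxS x : box n.+1 (tuple_snoc (t, x)) <-> box n t /\ 1 <= x.
  split=> [tx|[tb x1] i].
    split=> [i|].
      have := tx (widen_ord (leqnSn n) i).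
      by rewrite !(tnth_nth 0)/= nth_rcons size_tuple ltn_ord.
    by have := tx ord_max; rewrite (tnth_nth 0)/= nth_rcons size_tuple ltnn eqxx.
  rewrite (tnth_nth 0)/= nth_rcons size_tuple.
  case: ltnP => [ilt|ige]; first by have := tb (Ordinal ilt); rewrite (tnth_nth 0).
  by rewrite eqn_leq ige -ltnS ltn_ord.
case: ifPn => [/set_mem tb|tb]; last first.
  rewrite integral0_eq// => x _; rewrite patchE; case: ifPn => // /set_mem/boxS[tb'].
  by move: tb; rewrite mem_set.
have S0 : 0 <= S.
  rewrite /S sumr_ge0// => j _; apply: le_trans ler01 _.
  by have := tb j; rewrite (tnth_nth 0).
have ga : decays 2 (fun x => (x + S) ^- a * F (x + S)) by exact: decays_shift hd.
(* With the sum [S] of the first variables fixed, x >= 1 amounts to the total being at least S +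
   1. *)
rewrite EFinM /tail_op -/S addrC -(tail_shift S0 _ hd)// tailE//.
rewrite -ge0_integralZl_EFin//; first last.
- exact: fi0.
- apply/measurable_EFinP; exact: decays_measurable ga.
- by move=> x /=; rewrite in_itv/= andbT lee_fin => /(ga.2 _)/andP[].
rewrite [RHS]integral_mkcond; apply: eq_integral => x _; rewrite !patchE.
rewrite [in RHS]mem_setE in_itv/= andbT.
have -> : (tuple_snoc (t, x) \in box n.+1) = (1 <= x).
  by apply/idP/idP => [/set_mem/boxS[]//|x1]; apply/mem_set/boxS.
case: ifP => // x1; rewrite -EFinM /f; congr EFin.
rewrite czeta_integrand_rcons kn mulrA.
have -> : \sum_(j < n.+1) (tuple_snoc (t, x))`_j = x + S.
  rewrite big_ord_recr/= nth_rcons size_tuple ltnn eqxx addrC; congr (_ + _).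
  by apply: eq_bigr => j _; rewrite nth_rcons size_tuple ltn_ord.
congr (_ * _ * _); apply: eq_czeta_integrand => i ik.
by rewrite kn in ik; rewrite /= nth_rcons size_tuple ik.
Qed.

(** One factor of the last power is taken as the weight [Phi [::]], which lowers the last exponent
    from a + 1 to a. *)
Lemma czeta_tail_op r (k : seq nat) (a : nat) (t : r.-tuple nat) :
    val t = rcons k a.+1 -> all (leq 1) k -> (1 <= a)%N ->
  czeta R t = foldr (fun a => tail_op a 1) (Phi [::]) (rcons k a) 0.
Proof.
move=> tE k1 a1; have rE : size (rcons k a) = r.
  by rewrite -(size_tuple t) tE !size_rcons.
rewrite /czeta -[RHS]/(fine (EFin _)) -(integral_lebesgue_tuple_tail_op rE); first last.
- exact: (decays_Phi _ [::]).
- by rewrite all_rcons a1.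
congr fine; apply: eq_integral => x _; rewrite tE !czeta_integrand_rcons /=; congr EFin.
move: (tval x) => y; rewrite -rE size_rcons -mulrA; congr (_ * _).
by rewrite -invfM -exprSr.
Qed.

End multiple_integrals_as_tails.

(** * Rational spans *)

Section rational_span.
Variable R : realType.
Implicit Types (G H : set R) (x y : R).

Lemma Qspan0 G : Qspan G 0.
Proof.
exists 0%N, (fun=> 0), (fun=> 0); split; first by case.
by rewrite big_ord0.
Qed.

Lemma Qspan_cons G (q : rat) g x : G g -> Qspan G x -> Qspan G (ratr q * g + x).
Proof.
move=> Gg [n [a [h [Gh ->]]]].
exists n.+1, (fun i => if unlift ord0 i is Some j then a j else q),
  (fun i => if unlift ord0 i is Some j then h j else g); split.
  by move=> i; case: unliftP.
rewrite big_ord_recl unlift_none; congr (_ + _).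
by apply: eq_bigr => i _; rewrite liftK.
Qed.

Lemma Qspan_ind G (P : R -> Prop) : P 0 ->
  (forall q g x, G g -> P x -> P (ratr q * g + x)) -> forall x, Qspan G x -> P x.
Proof.
move=> P0 Padd _ [n [a [h [Gh ->]]]]; elim: n a h Gh => [|n ih] a h Gh.
  by rewrite big_ord0.
rewrite big_ord_recl; apply: Padd => //.
exact: (ih (fun i => a (lift ord0 i)) (fun i => h (lift ord0 i))).
Qed.

Lemma Qspan_gen G g : G g -> Qspan G g.
Proof.
move=> Gg; have := Qspan_cons 1 Gg (Qspan0 G).
by rewrite rmorph1 mul1r addr0.
Qed.

Lemma Qspan_lin G (q : rat) x y : Qspan G x -> Qspan G y -> Qspan G (ratr q * x + y).
Proof.
move=> + Gy; elim/Qspan_ind: x / => [|p g x Gg ih]; first by rewrite mulr0 add0r.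
rewrite mulrDr mulrA -rmorphM -addrA; exact: Qspan_cons.
Qed.

Lemma Qspan_min G H : G `<=` Qspan H -> Qspan G `<=` Qspan H.
Proof.
move=> GH x; elim/Qspan_ind: x / => [|q g x /GH Hg Hx]; first exact: Qspan0.
exact: Qspan_lin.
Qed.

Lemma Qspan_range n (b : 'I_n -> R) x : Qspan (range b) x ->
  exists a : 'I_n -> rat, x = \sum_i ratr (a i) * b i.
Proof.
elim/Qspan_ind: x / => [|q _ x [i _ <-] [a ->]].
  by exists (fun=> 0); rewrite big1// => i _; rewrite rmorph0 mul0r.
exists (fun j => (q *+ (j == i)) + a j).
under [RHS]eq_bigr do rewrite rmorphD mulrDl.
rewrite big_split/=; congr (_ + _).
rewrite (bigD1 i)//= eqxx big1 ?addr0// => j /negbTE ->.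
by rewrite mulr0n rmorph0 mul0r.
Qed.

(** A row in the left kernel of the coordinate matrix [M] is a rational relation among the [c i],
    hence zero; so [M] has rank n. *)
Lemma Qfree_size_le n N (c : 'I_n -> R) (b : 'I_N -> R) : Qfree c ->
  (forall i, Qspan (range b) (c i)) -> (n <= N)%N.
Proof.
move=> cfree cb.
have /choice[A cA] : forall i, exists a : 'I_N -> rat, c i = \sum_j ratr (a j) * b j.
  by move=> i; exact: Qspan_range.
pose M : 'M[rat]_(n, N) := \matrix_(i, j) A i j.
suff /eqP <- : row_free M by exact: rank_leq_col.
rewrite -kermx_eq0; apply/eqP/row_matrixP => i; rewrite row0.
have uM : row i (kermx M) *m M = 0 by rewrite -row_mul mulmx_ker row0.
move: (row i (kermx M)) uM => u uM; apply/rowP => k; rewrite mxE.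
apply: (cfree (fun k => u 0 k)).
under eq_bigr do rewrite cA mulr_sumr.
rewrite exchange_big big1// => j _.
have /rowP/(_ j) := uM; rewrite !mxE => /(congr1 (@ratr R)).
rewrite rmorph0 rmorph_sum/= => E.
transitivity (b j * \sum_i0 ratr (u 0 i0 * M i0 j)); last by rewrite E mulr0.
rewrite mulr_sumr; apply: eq_bigr => l _.
by rewrite mxE rmorphM; ring.
Qed.

(** Free families in [G] have length at most [N], and one of maximal length is a basis. *)
Lemma has_Qdim_leq N (G : set R) (b : 'I_N -> R) : G `<=` Qspan (range b) ->
  exists2 d, has_Qdim (Qspan G) d & (d <= N)%N.
Proof.
move=> Gb; pose P n := `[< exists2 c : 'I_n -> R, Qfree c & forall i, G (c i) >].
have P0 : exists n, P n.
  by exists 0%N; apply/asboolP; exists (fun=> 0); [move=> a _ []|case].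
have PN n : P n -> (n <= N)%N.
  move=> /asboolP[c cfree cG]; apply: Qfree_size_le cfree _ => i.
  exact: Gb.
case: (ex_maxnP P0 PN) => d /[dup] /PN dN /asboolP[c cfree cG] dmax.
exists d => //; exists c => //; apply/seteqP; split; last first.
  by apply: Qspan_min => _ [i _ <-]; exact: Qspan_gen.
apply: Qspan_min => g Gg; apply: contrapT => cg.
suff /dmax : P d.+1 by rewrite ltnn.
apply/asboolP; exists (fun i => if unlift ord0 i is Some j then c j else g); last first.
  by move=> i; case: unliftP.
move=> a; rewrite big_ord_recl unlift_none.
under eq_bigr do rewrite liftK.
move=> a0; have a00 : a ord0 = 0.
  apply: contrapT => /eqP a0N; apply: cg.
  (* A nonzero coefficient of [g] could be divided out, placing [g] in the span of [c]. *)
  have -> : g = \sum_(i < d) ratr (- (a ord0)^-1 * a (lift ord0 i)) * c i.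
    under eq_bigr do rewrite rmorphM -mulrA.
    rewrite -mulr_sumr rmorphN fmorphV/=.
    move: a0 => /eqP; rewrite addrC addr_eq0 => /eqP ->.
    by rewrite mulrNN mulrA mulVf ?mul1r// fmorph_eq0.
  by exists d, (fun i => - (a ord0)^-1 * a (lift ord0 i)), c; split=> // i; exists i.
move: a0; rewrite a00 rmorph0 mul0r add0r => /(cfree (fun i => a (lift ord0 i))) aS i.
by case: (unliftP ord0 i) => [j|] ->.
Qed.
End rational_span.

(* The entry of index [n] lists the compositions of [n.+1]. *)
Fixpoint compositions (n : nat) : seq (seq nat) :=
  if n is n'.+1 then
    map (cons 1%N) (compositions n') ++ map (add_head 1) (compositions n')
  else [:: [:: 1%N]].

Lemma size_compositions n : size (compositions n) = (2 ^ n)%N.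
Proof. by elim: n => // n ih /=; rewrite size_cat !size_map ih addnn -mul2n expnS. Qed.

(** A head equal to 1 is removed; a larger head is lowered by 1. *)
Lemma mem_compositions n m : all (leq 1) m -> sumn m = n.+1 -> m \in compositions n.
Proof.
elim: n m => [|n ih] [|[|[|b]] m]//= m1.
- by case: m m1 => [|[|b] m].
- move=> [mn]; rewrite mem_cat map_f//; exact: ih.
- move=> [mn]; rewrite mem_cat; apply/orP; right; apply/mapP.
  exists (b.+1 :: m); last by rewrite /= addn1.
  by apply: ih => //=; rewrite -mn addSn.
Qed.

(** * Spaces of continuous multiple zeta values *)

Section continuous_zeta_spaces.
Variable R : realType.
Implicit Types (F G : R -> R).

Local Notation tail_ops := (foldr (fun a => @tail_op R a 1)).

Lemma Gspan_tail_ops r F k : Gspan r F -> all (leq 1) k ->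
  Gspan (size k + r) (tail_ops F k).
Proof.
move=> HF; elim: k => //= a k ih /andP[a1 k1].
by rewrite -addn1 addnAC addnC; apply: Gspan_tail_op => //; exact: ih.
Qed.

Lemma tail_opsD r F G H k c : Gspan r F -> Gspan r G ->
    (forall y, 0 <= y -> H y = F y + G y) -> all (leq 1) k -> 0 <= c ->
  tail_ops H k c = tail_ops F k c + tail_ops G k c.
Proof.
move=> HF HG HE; elim: k c => [|a k ih] c /=; first by move=> _; exact: HE.
move=> /andP[a1 k1] c0.
have c1 : 1 <= c + 1%:R by rewrite lerDr.
rewrite -[X in X + _]mul1r -[X in _ + X]mul1r -tail_lincomb; last 2 first.
- exact: (Gspan_integrable a1 c1 (Gspan_tail_ops HF k1)).
- exact: (Gspan_integrable a1 c1 (Gspan_tail_ops HG k1)).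
apply: eq_tail => y cy; rewrite ih ?mul1r ?mulrDr//.
by rewrite (le_trans _ cy)// (le_trans ler01).
Qed.

Lemma Gspan_eval0 r F : Gspan r F -> czeta12_space R r (F 0).
Proof.
have H n : n != [::] -> all (leq 1) n -> sumn n = r -> czeta12_space R r (Phi n 0).
  move=> n0 n1 nr; apply: Qspan_gen; exists n; last by rewrite czeta12_Phi.
  by rewrite /= n1 nr eqxx andbT lt0n size_eq0 n0.
elim=> [n n0 n1 nr|a e n a1 n1 nr||q {}F G _ HF _ HG|{}F G FG _ HF].
- exact: H.
(* At 0 a shifted generator becomes a rational multiple, by [a ^- e], of [Phi (add_head a n) 0]. *)
- rewrite !add0r -[X in Phi n X]add0r -Phi_add_head ?add0r ?ltr0n//.
  have := H (add_head a n); rewrite sumn_add_head all_add_head// => /(_ _ isT nr).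
  move=> Ha; have := Qspan_lin (a%:R ^- e) (Ha _) (Qspan0 _).
  rewrite addr0 fmorphV/= rmorphXn/= ratr_nat; apply.
  by case: n {n1 nr Ha}.
- exact: Qspan0.
- exact: Qspan_lin.
- by rewrite -FG.
Qed.

(** The factor (y + 1)^-1 equals [Phi [:: 1] y], the integral over one further variable; this is how
    the depth increases. *)
Lemma tail_op_Phi_nil_split (p : nat) c : (1 <= p)%N -> 0 <= c ->
  tail_op p 1 (Phi [::]) c =
  tail_op p.+1 1 (tail_op 1 1 (Phi [::])) c +
  tail_op p 1 (tail_op 1 1 (Phi [::])) c :> R.
Proof.
move=> p1 c0; have c1 : 1 <= c + 1%:R by rewrite lerDr.
have G1 : Gspan 1 (@tail_op R 1 1 (Phi [::])).
  exact: (Gspan_tail_op_Phi_nil R (leqnn 1) (leqnn 1)).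
rewrite -[X in X + _]mul1r -[X in _ + X]mul1r -tail_lincomb; last 2 first.
- exact: (Gspan_integrable _ c1 G1).
- exact: (Gspan_integrable _ c1 G1).
apply: eq_tail => y cy; have y1 := le_trans c1 cy.
have y0 : 0 < y by apply: lt_le_trans y1.
have y1' : 0 < y + 1 by rewrite addr_gt0.
rewrite -[tail_op 1 1 (Phi [::]) y]/(Phi [:: 1%N] y).
rewrite (@Phi_add_head R 1 [::]) ?mulr1n//= exprS.
have := lt0r_neq0 (exprn_gt0 p y0); move: (y ^+ p) => u u0.
by field; rewrite u0 !gt_eqF.
Qed.

Lemma admissible_rcons (k : seq nat) : admissible k ->
  exists k' p, [/\ k = rcons k' p.+1, all (leq 1) k' & (1 <= p)%N].
Proof.
case/lastP: k => [|k a] /andP[]; first by [].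
rewrite all_rcons last_rcons => /andP[_ k1]; case: a => // p p1.
by exists k, p.
Qed.

Lemma czeta_in_czeta12_space r (k : r.-tuple nat) : admissible k ->
  czeta12_space R r (czeta R k).
Proof.
move=> /admissible_rcons[k' [p [kE k1 p1]]].
rewrite (czeta_tail_op R kE k1 p1) -cats1 foldr_cat/=; apply: Gspan_eval0.
(* All lower limits are 1, so each operator adds 1 to the weight and the final weight is the
   depth. *)
have <- : (size k' + 1)%N = r by rewrite -(size_tuple k) kE size_rcons addn1.
apply: Gspan_tail_ops => //; exact: Gspan_tail_op_Phi_nil.
Qed.

(** In terms of zeta values, zeta(k', p + 1) = zeta(k', p + 1, 2) + zeta(k', p, 2), and both indices
    on the right are admissible. *)
Lemma czeta_in_DZ_succ r (k : r.-tuple nat) : admissible k -> DZ R r.+1 (czeta R k).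
Proof.
move=> /admissible_rcons[k' [p [kE k1 p1]]].
have rE : r = (size k').+1 by rewrite -(size_tuple k) kE size_rcons.
have HG q : (1 <= q)%N -> Gspan 2 (tail_op q 1 (@tail_op R 1 1 (Phi [::]))).
  move=> q1; apply: (@Gspan_tail_op R 1 _ q 1) => //.
  exact: Gspan_tail_op_Phi_nil.
have HD q : (1 <= q)%N ->
    DZ R r.+1 (tail_ops (tail_op q 1 (tail_op 1 1 (Phi [::]))) k' 0).
  move=> q1; have sE : size (rcons (rcons k' q) 2%N) == r.+1 by rewrite !size_rcons rE.
  apply: Qspan_gen; exists (Tuple sE).
    by rewrite /= /admissible !all_rcons last_rcons k1 q1.
  rewrite (@czeta_tail_op R _ (rcons k' q) 1)//; last by rewrite all_rcons q1.
  by rewrite -!cats1 !foldr_cat.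
rewrite (czeta_tail_op R kE k1 p1) -cats1 foldr_cat/=.
have split y := @tail_op_Phi_nil_split p y p1.
rewrite (tail_opsD (HG p.+1 isT) (HG p p1) split k1 (lexx _)).
by rewrite -[X in X + _]mul1r -[1](@rmorph1 _ _ (@ratr R)); apply: Qspan_lin; exact: HD.
Qed.
End continuous_zeta_spaces.

Theorem theorem1p3 (R : realType) :
  [/\
      forall r : nat, (1 <= r)%N -> DZ R r `<=` DZ R r.+1,
      forall r : nat, (1 <= r)%N -> DZ R r `<=` czeta12_space R r &
      forall r : nat, (1 <= r)%N ->
        exists2 d : nat, has_Qdim (DZ R r) d & (d <= 2 ^ (r - 1))%N].
Proof.
have DZ_sub r : DZ R r `<=` czeta12_space R r.
  by apply: Qspan_min => _ [k kadm <-]; exact: czeta_in_czeta12_space.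
split=> [r _|r _|[//|r] _].
- by apply: Qspan_min => _ [k kadm <-]; exact: czeta_in_DZ_succ.
- exact: DZ_sub.
rewrite subn1/= -size_compositions.
(* The depth is now [r.+1], whose compositions are listed by [compositions r]. *)
apply: (has_Qdim_leq (b := fun i => czeta12 R (nth [::] (compositions r) i))).
move=> _ [k kadm <-]; have := czeta_in_czeta12_space R kadm.
apply: Qspan_min => _ [m /and3P[_ m1 /eqP mr] <-]; apply: Qspan_gen.
have mc := mem_compositions m1 mr.
have ilt : (index m (compositions r) < size (compositions r))%N by rewrite index_mem.
by exists (Ordinal ilt) => //=; rewrite nth_index.
Qed.
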